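(* Let $a, b, k_1, k_2 \in \mathbb{R}_{>0}$, let $Z$ be a real random variable with density $f_Z(z) = \frac{1}{2ab\Gamma(a)} \exp\left(-\left|\frac{z}{b}\right|^{\frac1a}\right)$, and let $L(z) = k_1 z$ for $z \ge 0$ and $L(z) = -k_2 z$ for $z < 0$. Let $C$ be the value of $c \in \mathbb{R}$ satisfying $\frac{d}{dc}\mathrm{E}[L(Z+c)] = 0$. Then $$\mathrm{V}[L(Z+C)] \le \mathrm{V}[L(Z)],$$ where equality holds only when $C=0$; that is, when $k_1 = k_2$.
   Context: $\Gamma(a) = \int_0^{+\infty} t^{a-1}e^{-t}\,dt$ is the gamma function, and $\gamma(a,x) = \int_0^x t^{a-1}e^{-t}\,dt$ ($a>0$, $x\ge 0$) is the lower incomplete gamma function. $\mathrm{E}$ and $\mathrm{V}$ denote expected value and variance. The number $C$ is the point at which $c \mapsto \mathrm{E}[L(Z+c)]$ attains its minimum over $\mathbb{R}$; equivalently, it is the real number satisfying $\gamma\left(a, \left|\frac{C}{b}\right|^{\frac1a}\right) = \mathrm{Sgn}(C)\frac{k_2-k_1}{k_1+k_2}\Gamma(a)$, where $\mathrm{Sgn}(c) = 1$ if $c \ge 0$ and $-1$ if $c<0$. *)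

(* Defs.v *)
From HB Require Import structures.
From mathcomp Require Import all_boot all_order all_algebra.
From mathcomp Require Import all_classical all_reals all_analysis.
Set Implicit Arguments.
Unset Strict Implicit.
Unset Printing Implicit Defensive.
Import Order.TTheory GRing.Theory Num.Theory.
Import numFieldNormedType.Exports.
Local Open Scope classical_set_scope.
Local Open Scope ring_scope.

(* The endpoint 0 is left out because t^(a-1) is singular there if a < 1. *)
Definition Gamma (R : realType) (a : R) : R :=
  \int[@lebesgue_measure R]_(t in `]0, +oo[) (t `^ (a - 1) * expR (- t)).

Definition gen_gauss_pdf (R : realType) (a b : R) (z : R) : R :=
  (2 * a * b * Gamma a)^-1 * expR (- (`|z / b| `^ a^-1)).

Definition has_density d (T : measurableType d) (R : realType)
    (P : probability T R) (Z : {RV P >-> R}) (f : R -> R) : Prop :=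
  forall A : set R, measurable A ->
    distribution P Z A = (\int[@lebesgue_measure R]_(z in A) (f z)%:E)%E.

Definition loss (R : realType) (k1 k2 : R) (z : R) : R :=
  if 0 <= z then k1 * z else - (k2 * z).

(* [fine] loses nothing under the density above: L(Z + c) is integrable. *)
Definition expected_loss d (T : measurableType d) (R : realType)
    (P : probability T R) (Z : {RV P >-> R}) (k1 k2 : R) (c : R) : R :=
  fine 'E_P[fun w => loss k1 k2 (Z w + c)].

(* Main.v *)
From HB Require Import structures.
Require Import Defs.
From mathcomp Require Import all_boot all_order all_algebra.
From mathcomp Require Import all_classical all_reals all_analysis.
From mathcomp Require Import measurable_realfun ring lra.
Import Order.TTheory GRing.Theory Num.Theory.
Import numFieldNormedType.Exports.
Local Open Scope classical_set_scope.
Local Open Scope ring_scope.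

Set Implicit Arguments.
Unset Strict Implicit.
Unset Printing Implicit Defensive.

(** Write [y = |z|], [d = (k1 - k2) / 2] and [s = (k1 + k2) / 2], so that
    [loss k1 k2 z = d z + s |z|].  Only four properties of the generalized
    Gaussian density [f] matter: it is positive, even, nonincreasing in [y],
    and has a finite second moment ([unimodal_density]).  The normalizing
    constant is never computed: that a law has density [f] says that [f] has
    integral [1], which is enough.

    For [c > 0] set [G = P(y <= c)], [A = E(y; y <= c)], [B = E(y; y > c)] and
    [W = E(y^2; y <= c)].  Averaging over [z] and [-z] gives
      [E|Z + c| = E max(y, c) = c G + B]  and
      [E(Z |Z + c|) = E(y min(y, c)) = W + c B].
    The first formula makes [d + s G] the derivative of the expected loss at
    [c] ([is_derive_mean_loss]), so [d = - s G] at the critical point.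
    Expanding the square ([variance_loss]) and substituting this value,
    [(V(c) - V(0)) / s^2] becomes
      [c^2 - (c G + B)^2 + (A + B)^2 - 2 G (W + c B)].
    This is negative by three inequalities:
    - [A <= c G / 2]: a nonincreasing density on [[0, c]] has its mean in the
      left half ([abs_le_le]);
    - [c (1 - G^2) <= 2 G B]: given [G], the tail moment [B] is smallest for
      the uniform law on [[0, c / G]] ([abs_gt_mass]);
    - [A^2 <= G W]: Cauchy-Schwarz ([sqr_le_ge]).
    Indeed they bound the expression by [c^2 (1 - G^2) - 3 c G B], which is at
    most [- c G B < 0] ([variance_gap_lt0]).  A negative critical point reduces
    to a positive one by exchanging [k1] and [k2].  Finally [G > 0] forces
    [d <> 0] whenever the critical point is not [0], so the critical point is
    [0] exactly when [k1 = k2]. *)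

(** * Integration against a law with a density *)

(** The Radon-Nikodym derivative of [nu] is almost everywhere equal to any
    density of [nu], and the change of variables for the former therefore holds
    for the latter. *)
Lemma ge0_integral_of_density d (X : measurableType d) (R : realType)
    (nu : {finite_measure set X -> \bar R})
    (mu : {sigma_finite_measure set X -> \bar R})
    (f phi : X -> \bar R) :
    measurable_fun [set: X] f -> (forall x, (0 <= f x)%E) ->
    (forall A, measurable A -> nu A = (\int[mu]_(x in A) f x)%E) ->
    measurable_fun [set: X] phi -> (forall x, (0 <= phi x)%E) ->
  (\int[nu]_x phi x = \int[mu]_x (phi x * f x))%E.
Proof.
move=> mf f0 nuf mphi phi0.
have dom : nu `<< mu.
  apply/null_content_dominatesP => A mA A0; rewrite nuf//.
  by apply: null_set_integral => //; exact: measurable_funTS.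
set rn := Radon_Nikodym_SigmaFinite.f nu mu.
have rni : mu.-integrable [set: X] rn.
  exact: Radon_Nikodym_SigmaFinite.f_integrable.
have rnf : ae_eq mu [set: X] rn f.
  apply: integral_ae_eq => // A _ mA.
  by rewrite -Radon_Nikodym_SigmaFinite.f_integral// nuf.
rewrite -(Radon_Nikodym_SigmaFinite.change_of_variables dom)//.
have mrn := measurable_int _ rni.
apply: ge0_ae_eq_integral => //.
- exact: emeasurable_funM.
- exact: emeasurable_funM.
- by move=> x _; rewrite mule_ge0// Radon_Nikodym_SigmaFinite.f_ge0.
- by move=> x _; rewrite mule_ge0.
- exact: ae_eqe_mul2l.
Qed.

Lemma expectation_density d (T : measurableType d) (R : realType)
    (P : probability T R) (Z : {RV P >-> R}) (f phi : R -> R) :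
    measurable_fun [set: R] f -> (forall z, 0 <= f z) -> has_density Z f ->
    measurable_fun [set: R] phi ->
  ('E_P[fun w => phi (Z w)] = \int[@lebesgue_measure R]_z (phi z * f z)%:E)%E.
Proof.
move=> mf f0 fZ mphi.
(* Lebesgue measure lives on the Borel structure [measurableTypeR R], which has
   another display than the default structure of [R]: [Z] is repackaged with
   the former as codomain. *)
have mZ : @measurable_fun _ _ T (measurableTypeR R) [set: T] Z.
  exact: (@measurable_funP _ _ T R setT Z).
pose Z' : {mfun T >-> measurableTypeR R} :=
  HB.pack (Z : T -> measurableTypeR R) (isMeasurableFun.Build _ _ _ _ _ mZ).
have transfer (psi : R -> \bar R) :
    measurable_fun [set: R] psi -> (forall z, (0 <= psi z)%E) ->
    (\int[P]_w psi (Z w) = \int[@lebesgue_measure R]_z (psi z * (f z)%:E))%E.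
  move=> mpsi psi0.
  transitivity (\int[distribution P Z']_z psi z)%E.
    by rewrite ge0_integral_distribution.
  refine (@ge0_integral_of_density _ (measurableTypeR R) R (distribution P Z')
    (@lebesgue_measure R) (EFin \o f) psi _ _ _ _ _) => //.
  exact/measurable_EFinP.
have mE : measurable_fun [set: R] (EFin \o phi) by exact/measurable_EFinP.
rewrite unlock integralE [RHS]integralE; congr (_ - _)%E.
- transitivity (\int[P]_w (EFin \o phi)^\+ (Z w))%E.
    by apply: eq_integral => w _; rewrite !funeposE.
  rewrite (transfer (EFin \o phi)^\+%E)//; last exact: measurable_funepos.
  apply: eq_integral => z _.
  by rewrite !funeposE/= EFinM maxe_pMl ?lee_fin// mul0e.
- transitivity (\int[P]_w (EFin \o phi)^\- (Z w))%E.
    by apply: eq_integral => w _; rewrite !funenegE.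
  rewrite (transfer (EFin \o phi)^\-%E)//; last exact: measurable_funeneg.
  apply: eq_integral => z _.
  by rewrite !funenegE/= maxe_pMl ?lee_fin// mul0e -!EFinM mulNr.
Qed.

(** * Reflection *)

(** Lebesgue measure and its image by [-%R] agree on half-open intervals, hence
    everywhere. *)
Lemma lebesgue_integral_opp (R : realType) (phi : R -> R) :
    measurable_fun [set: R] phi ->
  (\int[@lebesgue_measure R]_z (phi (- z))%:E
   = \int[@lebesgue_measure R]_z (phi z)%:E)%E.
Proof.
move=> mphi.
have mN :
    @measurable_fun _ _ (measurableTypeR R) (measurableTypeR R) [set: R] -%R.
  exact: oppr_measurable.
pose opp : {mfun measurableTypeR R >-> measurableTypeR R} :=
  HB.pack (-%R : measurableTypeR R -> measurableTypeR R)
    (isMeasurableFun.Build _ _ _ _ _ mN).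
have lebN A : measurable A ->
    @lebesgue_measure R A = pushforward (@lebesgue_measure R) opp A.
  apply: (@lebesgue_measure_unique R
    (pushforward (@lebesgue_measure R) opp)).
  move=> _ [[x y]/= _ <-].
  rewrite /pushforward (_ : _ @^-1` _ = `[- y, - x[%classic); last first.
    by apply/seteqP; split => z /=; rewrite !in_itv/= lerNl ltrNr andbC.
  rewrite !lebesgue_measure_itv/= !lte_fin ltrN2.
  by case: ifPn => // _; rewrite -!EFinB opprK addrC.
have ge0_opp (psi : R -> \bar R) :
    measurable_fun [set: R] psi -> (forall z, (0 <= psi z)%E) ->
    (\int[@lebesgue_measure R]_z psi (- (z : R))%R
     = \int[@lebesgue_measure R]_z psi z)%E.
  move=> mpsi psi0.
  rewrite [RHS](@eq_measure_integral _ _ _ _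
    (pushforward (@lebesgue_measure R) opp)); last first.
    by move=> A mA _; exact: lebN.
  by rewrite ge0_integral_pushforward.
have mE : measurable_fun [set: R] (EFin \o phi) by exact/measurable_EFinP.
rewrite integralE [RHS]integralE; congr (_ - _)%E.
- transitivity (\int[@lebesgue_measure R]_z ((EFin \o phi)^\+ (- (z : R))%R))%E.
    by apply: eq_integral => z _; rewrite !funeposE.
  by apply: (ge0_opp (EFin \o phi)^\+%E) => //; exact: measurable_funepos.
- transitivity (\int[@lebesgue_measure R]_z ((EFin \o phi)^\- (- (z : R))%R))%E.
    by apply: eq_integral => z _; rewrite !funenegE.
  by apply: (ge0_opp (EFin \o phi)^\-%E) => //; exact: measurable_funeneg.
Qed.

(** * Means under a symmetric unimodal density *)

(** Monotonicity is only asked on the half-line [[0, +oo[]; evenness extends it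
    to the other one. *)
Record unimodal_density (R : realType) (f : R -> R) : Prop := UnimodalDensity {
  ud_measurable : measurable_fun [set: R] f;
  ud_gt0 : forall z, 0 < f z;
  ud_even : forall z, f (- z) = f z;
  ud_noninc : forall x y, 0 <= x -> x <= y -> f y <= f x;
  ud_int1 : (\int[@lebesgue_measure R]_z (f z)%:E = 1)%E;
  ud_sqr : (@lebesgue_measure R).-integrable [set: R]
             (fun z : R => (z ^+ 2 * f z)%:E) }.

Definition mean (R : realType) (f phi : R -> R) : R :=
  \int[@lebesgue_measure R]_z (phi z * f z).

(** The class of integrands for which [mean] is linear and monotone: a finite
    second moment makes them all integrable, so that the default value of the
    real integral never shows up. *)
Definition subquadratic (R : realType) (phi : R -> R) : Prop :=
  measurable_fun [set: R] phi /\
  exists M : R, forall z, `|phi z| <= M * (1 + z ^+ 2).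

Section subquadratic.
Context {R : realType}.
Implicit Types (phi psi : R -> R) (k c : R).

Lemma subquadratic_cst k : subquadratic (fun=> k).
Proof.
split; first exact: measurable_cst.
by exists `|k| => z; rewrite ler_peMr// lerDl sqr_ge0.
Qed.

Lemma subquadratic_sqr : subquadratic (fun z : R => z ^+ 2).
Proof.
split; first exact: measurable_funX.
by exists 1 => z; rewrite mul1r ger0_norm ?sqr_ge0// lerDr.
Qed.

Lemma subquadratic_id : subquadratic (fun z : R => z).
Proof.
split; first exact: measurable_id.
exists 1 => z; rewrite mul1r -real_normK ?num_real//.
by have := sqr_ge0 (`|z| - 1 / 2); nra.
Qed.

Lemma subquadraticD phi psi : subquadratic phi -> subquadratic psi ->
  subquadratic (fun z => phi z + psi z).
Proof.
move=> [mphi [M hM]] [mpsi [N hN]]; split; first exact: measurable_funD.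
exists (M + N) => z; rewrite mulrDl.
by rewrite (le_trans (ler_normD _ _))// lerD.
Qed.

Lemma subquadraticZ k phi : subquadratic phi ->
  subquadratic (fun z => k * phi z).
Proof.
move=> [mphi [M hM]]; split; first exact: measurable_funM.
by exists (`|k| * M) => z; rewrite normrM -mulrA ler_wpM2l.
Qed.

Lemma le_subquadratic phi psi : measurable_fun [set: R] phi ->
  (forall z, `|phi z| <= `|psi z|) -> subquadratic psi -> subquadratic phi.
Proof.
move=> mphi le_phi_psi [_ [M hM]]; split => //.
by exists M => z; rewrite (le_trans (le_phi_psi z)).
Qed.

Lemma subquadratic_opp phi : subquadratic phi ->
  subquadratic (fun z => phi (- z)).
Proof.
move=> [mphi [M hM]]; split; first exact: measurableT_comp.
by exists M => z; rewrite -sqrrN.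
Qed.

Lemma subquadratic_if (b : R -> bool) phi psi : measurable_fun [set: R] b ->
  subquadratic phi -> subquadratic psi ->
  subquadratic (fun z => if b z then phi z else psi z).
Proof.
move=> mb [mphi [M hM]] [mpsi [N hN]]; split; first exact: measurable_fun_ifT.
exists (M + N) => z.
have M0 : 0 <= M * (1 + z ^+ 2) by apply: le_trans (hM z).
have N0 : 0 <= N * (1 + z ^+ 2) by apply: le_trans (hN z).
rewrite mulrDl; case: ifP => _.
  by rewrite (le_trans (hM z))// lerDl.
by rewrite (le_trans (hN z))// lerDr.
Qed.

Lemma subquadratic_normD c : subquadratic (fun z : R => `|z + c|).
Proof.
apply: (@le_subquadratic _ (fun z => z + c)).
- by apply: measurableT_comp => //; exact: measurable_funD.
- by move=> z; rewrite normr_id.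
- exact: subquadraticD subquadratic_id (subquadratic_cst c).
Qed.

Lemma subquadratic_mul_normD c : subquadratic (fun z : R => z * `|z + c|).
Proof.
apply: (@le_subquadratic _ (fun z => z ^+ 2 + c * z)).
- apply: measurable_funM => //.
  by apply: measurableT_comp => //; exact: measurable_funD.
- move=> z; rewrite normrM normr_id -normrM.
  by rewrite (_ : z * (z + c) = z ^+ 2 + c * z)//; ring.
- exact: subquadraticD subquadratic_sqr (subquadraticZ _ subquadratic_id).
Qed.

End subquadratic.

Section mean.
Context {R : realType} {f : R -> R}.
Context (uf : unimodal_density f).
Implicit Types (phi psi : R -> R) (k c : R).

Lemma integrable_density :
  (@lebesgue_measure R).-integrable [set: R] (EFin \o f).
Proof.
apply/integrableP; split.
  by apply/measurable_EFinP; exact: (ud_measurable uf).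
under eq_integral do rewrite /= ger0_norm ?(ltW (ud_gt0 uf _))//.
by rewrite ud_int1// ltry.
Qed.

Lemma subquadratic_integrable phi : subquadratic phi ->
  (@lebesgue_measure R).-integrable [set: R] (fun z => (phi z * f z)%:E).
Proof.
move=> [mphi [M hM]].
have := integrableZl measurableT M
  (integrableD measurableT integrable_density (ud_sqr uf)).
apply: le_integrable => //.
- apply/measurable_EFinP; apply: measurable_funM => //.
  exact: (ud_measurable uf).
- move=> z _ /=; rewrite lee_fin normrM (ger0_norm (ltW (ud_gt0 uf z))).
  rewrite (le_trans _ (ler_norm _))//.
  rewrite (_ : M * _ = M * (1 + z ^+ 2) * f z); last by ring.
  by rewrite ler_wpM2r// ltW// (ud_gt0 uf).
Qed.

Lemma eq_mean phi psi : phi =1 psi -> mean f phi = mean f psi.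
Proof. by move=> e; apply: eq_Rintegral => z _; rewrite e. Qed.

Lemma mean_cst k : mean f (fun=> k) = k.
Proof.
rewrite /mean RintegralZl//; last exact: integrable_density.
by rewrite /Rintegral ud_int1// mulr1.
Qed.

Lemma meanD phi psi : subquadratic phi -> subquadratic psi ->
  mean f (fun z => phi z + psi z) = mean f phi + mean f psi.
Proof.
move=> qphi qpsi.
rewrite /mean -RintegralD//; try exact: subquadratic_integrable.
by apply: eq_Rintegral => z _; rewrite mulrDl.
Qed.

Lemma meanZ k phi : subquadratic phi ->
  mean f (fun z => k * phi z) = k * mean f phi.
Proof.
move=> qphi; rewrite /mean -RintegralZl//; last exact: subquadratic_integrable.
by apply: eq_Rintegral => z _; rewrite mulrA.
Qed.

Lemma le_mean phi psi : subquadratic phi -> subquadratic psi ->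
  (forall z, phi z <= psi z) -> mean f phi <= mean f psi.
Proof.
move=> qphi qpsi le_phi_psi.
apply: le_Rintegral => //; try exact: subquadratic_integrable.
by move=> z _; rewrite ler_wpM2r// ltW// (ud_gt0 uf).
Qed.

Lemma mean_opp phi : measurable_fun [set: R] phi ->
  mean f (fun z => phi (- z)) = mean f phi.
Proof.
move=> mphi; congr fine; rewrite -[RHS]lebesgue_integral_opp.
  by apply: eq_integral => z _; rewrite (ud_even uf).
by apply: measurable_funM => //; exact: (ud_measurable uf).
Qed.

(** Under an even density a function has the same mean as its even part. *)
Lemma mean_fold phi psi : subquadratic phi -> subquadratic psi ->
  (forall z, phi z + phi (- z) = 2 * psi z) -> mean f phi = mean f psi.
Proof.
move=> qphi qpsi phipsi.
have qphiN := subquadratic_opp qphi.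
have := mean_opp (proj1 qphi); have := meanZ 2 qpsi.
rewrite -(eq_mean phipsi) meanD// => + e; rewrite e.
lra.
Qed.

End mean.

(** * Comparison with affine integrands on an interval *)

Section step_affine.
Context {R : realType}.
Implicit Types u v p q : R.

Lemma continuous_affine p q : continuous (fun z : R => p + q * z).
Proof.
move=> z; apply: cvgD; first exact: cvg_cst.
by apply: cvgM; [exact: cvg_cst|exact: cvg_id].
Qed.

Lemma integrable_itv_affine u v p q :
  (@lebesgue_measure R).-integrable `]u, v] (EFin \o (fun z : R => p + q * z)).
Proof.
apply: (@integrableS _ (measurableTypeR R) R (@lebesgue_measure R)
  `[u, v]%classic) => //.
  by apply: subset_itvr; rewrite bnd_simp.
apply: continuous_compact_integrable; first exact: segment_compact.
exact/continuous_subspaceT/continuous_affine.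
Qed.

Lemma patch_itv_affine u v p q :
  (fun z : R => if (u < z) && (z <= v) then p + q * z else 0)
  = (fun z => p + q * z) \_ `]u, v].
Proof.
apply/funext => z; rewrite patchE.
case: ifPn => h; first by rewrite mem_set//= in_itv.
by rewrite memNset//= in_itv; exact/negP.
Qed.

Lemma integrable_step_affine u v p q :
  (@lebesgue_measure R).-integrable [set: R]
    (EFin \o (fun z : R => if (u < z) && (z <= v) then p + q * z else 0)).
Proof.
rewrite patch_itv_affine -restrict_EFin.
by apply/integrable_restrict => //; rewrite setTI; exact: integrable_itv_affine.
Qed.

Lemma Rintegral_step_affine u v p q : u < v ->
  \int[@lebesgue_measure R]_z
    (if (u < z) && (z <= v) then p + q * z else 0)
  = p * (v - u) + q * (v ^+ 2 - u ^+ 2) / 2.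
Proof.
move=> uv; rewrite patch_itv_affine -Rintegral_mkcond.
rewrite Rintegral_itv_obnd_cbnd; last exact: integrable_itv_affine.
pose F (x : R) : R := p * x + q * (x ^+ 2) / 2.
have dF z : is_derive z (1 : R) F (p + q * z).
  by apply: is_derive_eq; rewrite /GRing.scale/=; field.
have cF z : {for z, continuous F}.
  by apply: differentiable_continuous; apply/derivable1_diffP.
rewrite /Rintegral (@continuous_FTC2 _ _ F)//=.
- by rewrite /F; field.
- exact/continuous_subspaceT/continuous_affine.
- split.
  + by move=> x _.
  + exact/cvg_at_right_filter/cF.
  + exact/cvg_at_left_filter/cF.
- by move=> x x01; rewrite derive1E derive_val.
Qed.

End step_affine.

Section comparison.
Context {R : realType} {f : R -> R}.
Context (uf : unimodal_density f).
Implicit Types (phi : R -> R) (u v p q c : R).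

(** The two comparison principles through which the monotonicity of the density
    enters: when [phi] is affine on []u, v]], replacing [f] by its value at one
    point there bounds [phi * f] by the affine function [p + q z]. *)
Lemma mean_le_step u v p q phi : u < v -> subquadratic phi ->
  (forall z, u < z -> z <= v -> phi z * f z <= p + q * z) ->
  (forall z, ~~ ((u < z) && (z <= v)) -> phi z <= 0) ->
  mean f phi <= p * (v - u) + q * (v ^+ 2 - u ^+ 2) / 2.
Proof.
move=> uv qphi phi_in phi_out; rewrite -Rintegral_step_affine//.
apply: le_Rintegral => //; first exact: subquadratic_integrable.
  exact: integrable_step_affine.
move=> z _; case: ifPn => [/andP[uz zv]|out]; first exact: phi_in.
by rewrite mulr_le0_ge0 ?phi_out// ltW// (ud_gt0 uf).
Qed.

Lemma mean_ge_step u v p q phi : u < v -> subquadratic phi ->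
  (forall z, u < z -> z <= v -> p + q * z <= phi z * f z) ->
  (forall z, ~~ ((u < z) && (z <= v)) -> 0 <= phi z) ->
  p * (v - u) + q * (v ^+ 2 - u ^+ 2) / 2 <= mean f phi.
Proof.
move=> uv qphi phi_in phi_out; rewrite -Rintegral_step_affine//.
apply: le_Rintegral => //; [exact: integrable_step_affine|
  exact: subquadratic_integrable|].
move=> z _; case: ifPn => [/andP[uz zv]|out]; first exact: phi_in.
by rewrite mulr_ge0 ?phi_out// ltW// (ud_gt0 uf).
Qed.

End comparison.

(** * Truncated absolute moments *)

(** Decides every order test guarding an [if] of the goal. *)
Ltac step_cases := repeat match goal with
  | |- context [if ?b then _ else _] => match b with
    | context [(?x <= ?y)%R] => case: (lerP x y) => ?
    | context [(?x < ?y)%R] => case: (ltrP x y) => ?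
    end; rewrite ?andbT ?andbF /=
  end.

Section truncated_moments.
Context {R : realType} (f : R -> R).
Implicit Types (c : R).

(** With [y = |z|] these are [P(y <= c)], [E(y; y <= c)], [E(y; y > c)] and
    [E(y^2; y <= c)]. *)
Definition mass_le c := mean f (fun z => if `|z| <= c then 1 else 0).
Definition abs_le c := mean f (fun z => if `|z| <= c then `|z| else 0).
Definition abs_gt c := mean f (fun z => if `|z| <= c then 0 else `|z|).
Definition sqr_le c := mean f (fun z => if `|z| <= c then z ^+ 2 else 0).

End truncated_moments.

Section truncated_moments_theory.
Context {R : realType} {f : R -> R}.
Context (uf : unimodal_density f).
Implicit Types (phi psi : R -> R) (c r t : R).

Lemma measurable_normr_le c : measurable_fun [set: R] (fun z : R => `|z| <= c).
Proof. by apply: measurable_fun_ler. Qed.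

Lemma measurable_itv_oc (u v : R) :
  measurable_fun [set: R] (fun z : R => (u < z) && (z <= v)).
Proof.
by apply: measurable_and; [exact: measurable_fun_ltr|exact: measurable_fun_ler].
Qed.

Lemma subquadratic_normr : subquadratic (fun z : R => `|z|).
Proof.
apply: (@le_subquadratic _ _ id) => // [z|]; first by rewrite normr_id.
exact: subquadratic_id.
Qed.

Lemma subquadratic_trunc c phi psi : subquadratic phi -> subquadratic psi ->
  subquadratic (fun z => if `|z| <= c then phi z else psi z).
Proof.
by move=> ? ?; apply: subquadratic_if => //; exact: measurable_normr_le.
Qed.

(** One-sided forms of [mean_fold], which reduce the mean of an even [phi] to
    that of some [psi] supported on a half-line.  An inequality is asked because
    [phi] and the sum of [psi] and its reflection may differ at [z = 0]. *)
Lemma le_mean_fold phi psi : subquadratic phi -> subquadratic psi ->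
  (forall z, phi z <= psi z + psi (- z)) -> mean f phi <= 2 * mean f psi.
Proof.
move=> qphi qpsi le_phi_psi.
have qpsiN := subquadratic_opp qpsi.
rewrite mulr_natl mulr2n -[X in _ <= _ + X](mean_opp uf (proj1 qpsi)) -meanD//.
by apply: le_mean => //; exact: subquadraticD.
Qed.

Lemma ge_mean_fold phi psi : subquadratic phi -> subquadratic psi ->
  (forall z, psi z + psi (- z) <= phi z) -> 2 * mean f psi <= mean f phi.
Proof.
move=> qphi qpsi le_phi_psi.
have qpsiN := subquadratic_opp qpsi.
rewrite mulr_natl mulr2n -[X in _ + X <= _](mean_opp uf (proj1 qpsi)) -meanD//.
by apply: le_mean => //; exact: subquadraticD.
Qed.

Let q1 := @subquadratic_cst R 1.
Let q0 := @subquadratic_cst R 0.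
Let qn := subquadratic_normr.
Let qs := @subquadratic_sqr R.

(** The density is at least [f c] on [[- c, c]]. *)
Lemma mass_le_ge c : 0 < c -> 2 * (f c * c) <= mass_le f c.
Proof.
move=> c0; pose psi (z : R) : R := if (0 < z) && (z <= c) then 1 else 0.
have qpsi : subquadratic psi.
  by apply: subquadratic_if => //; exact: measurable_itv_oc.
apply: (@le_trans _ _ (2 * mean f psi)).
  rewrite ler_pM2l//.
  have := @mean_ge_step _ _ uf 0 c (f c) 0 psi c0 qpsi.
  rewrite subr0 !mul0r addr0; apply.
    move=> z z0 zc; rewrite /psi z0 zc/= mul0r addr0 mul1r.
    by apply: (ud_noninc uf) => //; exact: ltW.
  by move=> z; rewrite /psi; case: ifP.
apply: ge_mean_fold => //; first exact: subquadratic_trunc.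
move=> z; rewrite /psi; case: (ger0P z) => z0; step_cases; lra.
Qed.

(** The interval []c, c + 1]] has mass at least [f (c + 1) > 0]. *)
Lemma mass_le_lt1 c : 0 <= c -> mass_le f c < 1.
Proof.
move=> c0; pose psi (z : R) : R := if (c < z) && (z <= c + 1) then 1 else 0.
have qpsi : subquadratic psi.
  by apply: subquadratic_if => //; exact: measurable_itv_oc.
have psi_gt0 : 0 < mean f psi.
  apply: (lt_le_trans (ud_gt0 uf (c + 1))).
  have cc1 : c < c + 1 by rewrite ltrDl.
  have := @mean_ge_step _ _ uf c (c + 1) (f (c + 1)) 0 psi cc1 qpsi.
  rewrite addrAC subrr add0r mulr1 !mul0r addr0; apply.
    move=> z z0 zc; rewrite /psi z0 zc/= mul0r addr0 mul1r.
    by apply: (ud_noninc uf) => //; lra.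
  by move=> z; rewrite /psi; case: ifP.
rewrite -subr_gt0 (lt_le_trans psi_gt0)// lerBrDr -[leRHS](mean_cst uf 1).
have qtrunc : subquadratic (fun z : R => if `|z| <= c then 1 else 0 : R).
  exact: subquadratic_trunc.
rewrite -meanD//; apply: le_mean => //; first exact: subquadraticD.
move=> z; rewrite /psi; case: (ger0P z) => z0; step_cases; lra.
Qed.

(** The function [y - c / 2] is negative, then positive on [[0, c]], and has
    integral [0] there; weighting it with a nonincreasing density can only make
    the integral smaller.  The comparison freezes the density at [c / 2], where
    the sign changes. *)
Lemma abs_le_le c : 0 < c -> abs_le f c <= c / 2 * mass_le f c.
Proof.
move=> c0.
pose psi (z : R) : R := if (0 < z) && (z <= c) then - (c / 2) + z else 0.
have qpsi : subquadratic psi.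
  apply: subquadratic_if => //; first exact: measurable_itv_oc.
  by apply: subquadraticD; [exact: subquadratic_cst|exact: subquadratic_id].
have psi_le0 : mean f psi <= 0.
  have := @mean_le_step _ _ uf 0 c
    (- (c / 2) * f (c / 2)) (f (c / 2)) psi c0 qpsi.
  rewrite (_ : _ + _ = 0); last by field.
  apply; last by move=> z; rewrite /psi => /negbTE ->.
  move=> z z0 zc; rewrite /psi z0 zc/=.
  have [zc2|/ltW zc2] := lerP z (c / 2).
    by have := ud_noninc uf (ltW z0) zc2; nra.
  by have := @ud_noninc _ _ uf (c / 2) z _ zc2; nra.
have qG : subquadratic (fun z : R => if `|z| <= c then 1 else 0 : R).
  exact: subquadratic_trunc.
have qA : subquadratic (fun z : R => if `|z| <= c then `|z| else 0 : R).
  exact: subquadratic_trunc.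
rewrite -subr_le0 -mulNr -meanZ// -meanD//; last exact: subquadraticZ.
apply: (@le_trans _ _ (2 * mean f psi)); last by rewrite pmulr_rle0.
apply: le_mean_fold => //.
  by apply: subquadraticD => //; exact: subquadraticZ.
move=> z; rewrite /psi; case: (ger0P z) => z0; step_cases; lra.
Qed.

(** Bathtub principle for the tail: in [E(y - r; y > c)] the part [y > r] is
    nonnegative, and on []c, r]] the negative integrand is weighted by a density
    that is at most [f c].  The square comes from integrating [r - y] over
    []c, r]] on both half-lines. *)
Lemma abs_gt_ge c r : 0 < c -> c < r ->
  r * (1 - mass_le f c) - f c * (r - c) ^+ 2 <= abs_gt f c.
Proof.
move=> c0 cr.
pose psi (z : R) : R := if z <= c then 0 else - r + z.
have qpsi : subquadratic psi.
  apply: subquadratic_if => //; first exact: measurable_fun_ler.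
  by apply: subquadraticD; [exact: subquadratic_cst|exact: subquadratic_id].
have psi_ge : - (f c * (r - c) ^+ 2 / 2) <= mean f psi.
  have := @mean_ge_step _ _ uf c r (- r * f c) (f c) psi cr qpsi.
  rewrite (_ : _ + _ = - (f c * (r - c) ^+ 2 / 2)); last by field.
  apply; last first.
    move=> z; rewrite /psi.
    by case: (ltrP c z); case: (lerP z c); case: (lerP z r) => //=; lra.
  move=> z cz zr; rewrite /psi ifN -?ltNge//.
  by have := ud_noninc uf (ltW c0) (ltW cz); nra.
have qG : subquadratic (fun z : R => if `|z| <= c then 1 else 0 : R).
  exact: subquadratic_trunc.
have qB : subquadratic (fun z : R => if `|z| <= c then 0 else `|z| : R).
  exact: subquadratic_trunc.
have : 2 * mean f psi <= abs_gt f c + (- r + r * mass_le f c).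
  rewrite /abs_gt /mass_le -[X in _ <= _ + (X + _)](mean_cst uf).
  rewrite -[X in _ <= _ + (_ + X)]meanZ//.
  have qr := subquadratic_cst (- r).
  have qrG := subquadraticZ r qG.
  have qrr := subquadraticD qr qrG.
  rewrite -meanD// -meanD//; apply: ge_mean_fold => //.
    exact: subquadraticD.
  move=> z; rewrite /psi; case: (ger0P z) => z0; step_cases; lra.
lra.
Qed.

(** The mean of [(y - t)^2] over [y <= c] is nonnegative; with [t] free this is
    the Cauchy-Schwarz inequality. *)
Lemma sqr_le_ge c t :
  0 <= sqr_le f c - 2 * t * abs_le f c + t ^+ 2 * mass_le f c.
Proof.
have qG : subquadratic (fun z : R => if `|z| <= c then 1 else 0 : R).
  exact: subquadratic_trunc.
have qA : subquadratic (fun z : R => if `|z| <= c then `|z| else 0 : R).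
  exact: subquadratic_trunc.
have qW : subquadratic (fun z : R => if `|z| <= c then z ^+ 2 else 0 : R).
  exact: subquadratic_trunc.
have qtA := subquadraticZ (- (2 * t)) qA.
have qtG := subquadraticZ (t ^+ 2) qG.
have qAG := subquadraticD qtA qtG.
have -> : sqr_le f c - 2 * t * abs_le f c + t ^+ 2 * mass_le f c =
    mean f (fun z => (if `|z| <= c then z ^+ 2 else 0)
      + (- (2 * t) * (if `|z| <= c then `|z| else 0)
         + t ^+ 2 * (if `|z| <= c then 1 else 0))).
  by rewrite meanD// meanD// !meanZ// addrA mulNr.
rewrite -[leLHS](mean_cst uf 0); apply: le_mean => //.
  exact: subquadraticD.
move=> z; step_cases.
  by rewrite -(real_normK (num_real z)); have := sqr_ge0 (`|z| - t); lra.
by lra.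
Qed.

End truncated_moments_theory.

(** * Moments of the shifted loss *)

Lemma lossE (R : realType) (k1 k2 z : R) :
  loss k1 k2 z = (k1 - k2) / 2 * z + (k1 + k2) / 2 * `|z|.
Proof. by rewrite /loss; case: ger0P => _; field. Qed.

Lemma subquadratic_loss (R : realType) (k1 k2 c : R) :
  subquadratic (fun z : R => loss k1 k2 (z + c)).
Proof.
rewrite (_ : (fun z => _) = fun z =>
    (k1 - k2) / 2 * (z + c) + (k1 + k2) / 2 * `|z + c|); last first.
  by apply/funext => z; rewrite lossE.
apply: subquadraticD; apply: subquadraticZ; last exact: subquadratic_normD.
exact: subquadraticD (@subquadratic_id R) (subquadratic_cst c).
Qed.

Lemma subquadratic_sqr_loss (R : realType) (k1 k2 c v : R) :
  subquadratic (fun z : R => (loss k1 k2 (z + c) - v) ^+ 2).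
Proof.
have mL : measurable_fun [set: R] (fun z : R => loss k1 k2 (z + c)).
  exact: (proj1 (subquadratic_loss k1 k2 c)).
pose p := `|(k1 - k2) / 2| + `|(k1 + k2) / 2|.
have p0 : 0 <= p by rewrite addr_ge0.
pose q := p * `|c| + `|v|.
have q0 : 0 <= q by rewrite addr_ge0// mulr_ge0.
apply: (@le_subquadratic _ _ (fun z => 2 * p ^+ 2 * z ^+ 2 + 2 * q ^+ 2)).
- by apply: measurable_funX; exact: measurable_funB.
- move=> z; rewrite normrX [leRHS]ger0_norm; last first.
    have [pp qq] := (sqr_ge0 p, sqr_ge0 q); have zz := sqr_ge0 z.
    by apply: addr_ge0; [apply: mulr_ge0 => //|]; apply: mulr_ge0.
  have : `|loss k1 k2 (z + c) - v| <= p * `|z| + q.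
    rewrite lossE /q /p; move: (_ / 2) ((k1 + k2) / 2) => s t.
    rewrite (le_trans (ler_normB _ _))// addrA lerD2r -mulrDr.
    rewrite (le_trans (ler_normD _ _))// !normrM normr_id mulrDl.
    by apply: lerD; apply: ler_wpM2l => //; exact: ler_normD.
  rewrite -(@ler_pXn2r _ 2)// ?nnegrE; last first.
    by rewrite addr_ge0// mulr_ge0.
  move=> h; apply: (le_trans h).
  rewrite -[z ^+ 2](real_normK (num_real z)).
  by have := sqr_ge0 (p * `|z| - q); lra.
- apply: subquadraticD; last exact: subquadratic_cst.
  exact: subquadraticZ (@subquadratic_sqr R).
Qed.

Section shifted_moments.
Context {R : realType} {f : R -> R}.
Context (uf : unimodal_density f).
Implicit Types (c : R).

Let q1 := @subquadratic_cst R 1.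
Let q0 := @subquadratic_cst R 0.
Let qi := @subquadratic_id R.
Let qn := @subquadratic_normr R.
Let qs := @subquadratic_sqr R.

Lemma mean_id : mean f (fun z => z) = 0.
Proof.
rewrite -(mean_cst uf 0); apply: (mean_fold uf) => // z.
by rewrite subrr mulr0.
Qed.

Lemma mean_normrD_opp c :
  mean f (fun z => `|z - c|) = mean f (fun z => `|z + c|).
Proof.
rewrite -[RHS](mean_opp uf); last exact: (proj1 (subquadratic_normD c)).
by apply: eq_mean => z; rewrite -normrN opprB addrC.
Qed.

Lemma mean_mul_normrD_opp c :
  mean f (fun z => z * `|z - c|) = - mean f (fun z => z * `|z + c|).
Proof.
rewrite -[in RHS](mean_opp uf); last exact: (proj1 (subquadratic_mul_normD c)).
rewrite -[RHS]mulN1r -meanZ//; last first.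
  exact: subquadratic_opp (subquadratic_mul_normD c).
by apply: eq_mean => z; rewrite mulN1r mulNr opprK -normrN opprB addrC.
Qed.

Lemma mean_normr_split c : mean f (fun z => `|z|) = abs_le f c + abs_gt f c.
Proof.
have qA : subquadratic (fun z : R => if `|z| <= c then `|z| else 0 : R).
  exact: subquadratic_trunc.
have qB : subquadratic (fun z : R => if `|z| <= c then 0 else `|z| : R).
  exact: subquadratic_trunc.
by rewrite /abs_le /abs_gt -meanD//; apply: eq_mean => z; step_cases; lra.
Qed.

(** The even part of [z |-> |z + c|] is [max(y, c)]. *)
Lemma mean_normrD c : 0 <= c ->
  mean f (fun z => `|z + c|) = c * mass_le f c + abs_gt f c.
Proof.
move=> c0.
have qG : subquadratic (fun z : R => if `|z| <= c then 1 else 0 : R).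
  exact: subquadratic_trunc.
have qB : subquadratic (fun z : R => if `|z| <= c then 0 else `|z| : R).
  exact: subquadratic_trunc.
have qcG := subquadraticZ c qG.
rewrite /mass_le /abs_gt -meanZ// -meanD//; apply: (mean_fold uf) => //.
- exact: subquadratic_normD.
- exact: subquadraticD.
- move=> z; case: (ger0P z) => ?; case: (ger0P (z + c)) => ?;
  case: (ger0P (- z + c)) => ?; step_cases; lra.
Qed.

(** The even part of [z |-> z |z + c|] is [y min(y, c)]. *)
Lemma mean_mul_normrD c : 0 <= c ->
  mean f (fun z => z * `|z + c|) = sqr_le f c + c * abs_gt f c.
Proof.
move=> c0.
have qW : subquadratic (fun z : R => if `|z| <= c then z ^+ 2 else 0 : R).
  exact: subquadratic_trunc.
have qB : subquadratic (fun z : R => if `|z| <= c then 0 else `|z| : R).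
  exact: subquadratic_trunc.
have qcB := subquadraticZ c qB.
rewrite /sqr_le /abs_gt -meanZ// -meanD//; apply: (mean_fold uf) => //.
- exact: subquadratic_mul_normD.
- exact: subquadraticD.
- move=> z; case: (ger0P z) => ?; case: (ger0P (z + c)) => ?;
  case: (ger0P (- z + c)) => ?; step_cases; nra.
Qed.

Lemma mean_loss k1 k2 c : mean f (fun z => loss k1 k2 (z + c)) =
  (k1 - k2) / 2 * c + (k1 + k2) / 2 * mean f (fun z => `|z + c|).
Proof.
set d := (k1 - k2) / 2; set s := (k1 + k2) / 2.
have qi_d := subquadraticZ d qi.
have qm := subquadratic_normD c.
have qn_s := subquadraticZ s qm.
have qc := subquadratic_cst (d * c).
have q_ds := subquadraticD qi_d qn_s.
transitivity (mean f (fun z => d * c + (d * z + s * `|z + c|))).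
  by apply: eq_mean => z; rewrite lossE -/s -/d; ring.
by rewrite meanD// meanD// (mean_cst uf) !meanZ// mean_id mulr0 add0r.
Qed.

(** Since [|z + c|^2 = (z + c)^2], the centred square is a combination of [1],
    [z], [z^2], [|z + c|] and [z |z + c|]. *)
Lemma variance_loss c k1 k2 (s := (k1 + k2) / 2) (d := (k1 - k2) / 2)
    (L := fun z => loss k1 k2 (z + c)) :
  mean f (fun z => (L z - mean f L) ^+ 2) =
  (d ^+ 2 + s ^+ 2) * mean f (fun z => z ^+ 2)
  + s ^+ 2 * (c ^+ 2 - mean f (fun z => `|z + c|) ^+ 2)
  + 2 * d * s * mean f (fun z => z * `|z + c|).
Proof.
have qm := subquadratic_normD c.
have qh := subquadratic_mul_normD c.
rewrite /L mean_loss -/s -/d; set m := mean f (fun z => `|z + c|).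
have q5 := subquadratic_cst (s ^+ 2 * (c ^+ 2 + m ^+ 2)).
have q4 := subquadraticZ (- (2 * s ^+ 2 * m)) qm.
have q3 := subquadraticZ (2 * d * s) qh.
have q2 := subquadraticZ (2 * c * s ^+ 2 - 2 * d * s * m) qi.
have q6 := subquadraticZ (d ^+ 2 + s ^+ 2) qs.
have q45 := subquadraticD q4 q5.
have q345 := subquadraticD q3 q45.
have q2345 := subquadraticD q2 q345.
transitivity (mean f (fun z => (d ^+ 2 + s ^+ 2) * z ^+ 2 +
   ((2 * c * s ^+ 2 - 2 * d * s * m) * z + (2 * d * s * (z * `|z + c|)
     + (- (2 * s ^+ 2 * m) * `|z + c| + s ^+ 2 * (c ^+ 2 + m ^+ 2)))))).
  apply: eq_mean => z; rewrite lossE -/s -/d.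
  have e := real_normK (num_real (z + c)).
  apply/eqP; rewrite -subr_eq0; apply/eqP.
  (* the two sides differ only in how the square of [|z + c|] is written *)
  transitivity (s ^+ 2 * (`|z + c| ^+ 2 - (z + c) ^+ 2)); first by ring.
  by rewrite e subrr mulr0.
rewrite meanD// meanD// meanD// meanD// (mean_cst uf) !meanZ// mean_id.
by rewrite -/m; ring.
Qed.

End shifted_moments.

(** * Derivative of the expected loss *)

Lemma is_derive_quadratic_remainder (R : realType) (g : R -> R) (x D K : R) :
  (forall h, `|g (x + h) - g x - h * D| <= K * h ^+ 2) ->
  is_derive x (1 : R) g D.
Proof.
move=> gD.
have cv : h^-1 *: ((g \o shift x) (h *: (1 : R)) - g x) @[h --> 0^'] --> D.
  apply/cvgrPdist_le => /= e e0.
  near=> h.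
  have h0 : h != 0 by near: h; exact: nbhs_dnbhs_neq.
  have hn0 : 0 < `|h| by rewrite normr_gt0.
  rewrite /GRing.scale/= mulr1 -(ler_pM2l hn0) -normrM mulrBr mulrA divff//.
  rewrite mul1r.
  rewrite distrC [h + x]addrC; apply: (le_trans (gD h)).
  have hK : `|h| * (`|K| + 1) <= e.
    rewrite -ler_pdivlMr ?ltr_pwDr//; near: h.
    by apply: dnbhs0_le; rewrite divr_gt0// ltr_pwDr.
  rewrite -(real_normK (num_real h)) expr2 mulrA mulrC ler_pM2l//.
  by have := ler_norm K; nra.
split; [exact: cvgP cv|exact: cvg_lim cv].
Unshelve. all: by end_near.
Qed.

Section loss_derivative.
Context {R : realType} {f : R -> R}.
Context (uf : unimodal_density f).
Implicit Types (c t h : R).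

Let qn := @subquadratic_normr R.

Lemma density_le0 z : f z <= f 0.
Proof.
case: (lerP 0 z) => z0; first by apply: (ud_noninc uf).
by rewrite -(ud_even uf); apply: (ud_noninc uf) => //; rewrite oppr_ge0 ltW.
Qed.

Lemma subquadratic_max t : subquadratic (fun z : R => Num.max `|z| t).
Proof.
apply: (@le_subquadratic _ _ (fun z : R => `|z| + `|t|)).
- exact: measurable_maxr.
- move=> z; rewrite [leRHS]ger0_norm ?addr_ge0//.
  by rewrite /Num.max; case: ifP => _; rewrite ?normr_id (lerDl, lerDr).
- exact: subquadraticD qn (subquadratic_cst _).
Qed.

(** The function [t |-> max(y, t)] has slope [1] for [t > y] and [0] for
    [t < y], so its increment from [t] to [t + h] differs from [h 1(y <= t)]
    only if [y] is within [|h|] of [t], and then by at most [|h|].  As the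
    density is bounded by [f 0], this happens with probability [O(|h|)]: the
    remainder is quadratic. *)
Lemma mean_max_remainder t h :
  `|mean f (fun z => Num.max `|z| (t + h)) - mean f (fun z => Num.max `|z| t)
    - h * mass_le f t| <= 4 * f 0 * h ^+ 2.
Proof.
have [->|h0] := eqVneq h 0.
  by rewrite addr0 subrr mul0r subrr normr0 expr0n mulr0.
have nh0 : 0 < `|h| by rewrite normr_gt0.
pose psi (z : R) : R :=
  if (t - `|h| < z) && (z <= t + `|h|) then `|h| else 0.
have qpsi : subquadratic psi.
  apply: subquadratic_if; first exact: measurable_itv_oc.
    exact: subquadratic_cst.
  exact: subquadratic_cst.
have psi_le : mean f psi <= 2 * f 0 * h ^+ 2.
  have tt : t - `|h| < t + `|h| by lra.
  have := @mean_le_step _ _ uf _ _ (`|h| * f 0) 0 psi tt qpsi.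
  rewrite !mul0r addr0 (_ : _ * _ = 2 * f 0 * h ^+ 2); last first.
    by rewrite -(real_normK (num_real h)); ring.
  apply; last by move=> z; rewrite /psi => /negbTE ->.
  move=> z z1 z2; rewrite /psi z1 z2/= mul0r addr0.
  by rewrite ler_pM2l// density_le0.
pose r (z : R) : R := Num.max `|z| (t + h) + (-1) * Num.max `|z| t
  + - h * (if `|z| <= t then 1 else 0).
have qG : subquadratic (fun z : R => if `|z| <= t then 1 else 0 : R).
  by apply: subquadratic_trunc; exact: subquadratic_cst.
have qM1 := subquadratic_max (t + h).
have qM2 := subquadraticZ (-1) (subquadratic_max t).
have qhG := subquadraticZ (- h) qG.
have qM := subquadraticD qM1 qM2.
have qr : subquadratic r by exact: subquadraticD.
have <- : mean f r = mean f (fun z => Num.max `|z| (t + h))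
    - mean f (fun z => Num.max `|z| t) - h * mass_le f t.
  rewrite /r meanD// meanD// meanZ//; last exact: subquadratic_max.
  by rewrite meanZ// mulN1r mulNr.
have r_ge0 : 0 <= mean f r.
  rewrite -[leLHS](mean_cst uf 0); apply: le_mean => //.
    exact: subquadratic_cst.
  move=> z; rewrite /r.
  case: (lerP `|z| t) => zt; case: (lerP `|z| (t + h)) => zth; lra.
rewrite ger0_norm//.
apply: (@le_trans _ _ (2 * mean f psi)); last by lra.
have psi_ge0 z : 0 <= psi z by rewrite /psi; case: ifP.
have r_le y : Num.max y (t + h) + (-1) * Num.max y t
    + - h * (if y <= t then 1 else 0) <= psi y.
  rewrite /psi; case: (lerP y t) => ?; case: (lerP y (t + h)) => ?;
  case: (ger0P h) => ?; step_cases; lra.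
apply: le_mean_fold => // z; rewrite /r; case: (ger0P z) => _.
  by rewrite (le_trans (r_le _))// lerDl.
by rewrite (le_trans (r_le _))// lerDr.
Qed.

(** This form holds for both signs of [c]: the maximum with the negative one of
    [c] and [- c] is just [y], which the last term cancels.  It transfers the
    derivative of [E max(y, t)] to [E|Z + c|] with no case split on the sign
    of [c]. *)
Lemma mean_normrD_max c : mean f (fun z => `|z + c|) =
  mean f (fun z => Num.max `|z| c) + mean f (fun z => Num.max `|z| (- c))
  - mean f (fun z => `|z|).
Proof.
have q1 := subquadratic_max c.
have q2 := subquadratic_max (- c).
have q3 := subquadraticZ (-1) qn.
have q23 := subquadraticD q2 q3.
rewrite -[- mean f _]mulN1r -addrA -meanZ// -meanD// -meanD//.
apply: (mean_fold uf) => //; first exact: subquadratic_normD.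
  exact: subquadraticD.
move=> z; case: (lerP `|z| c); case: (lerP `|z| (- c)); case: (ger0P z) => ?;
  case: (ger0P (z + c)) => ?; case: (ger0P (- z + c)) => ? ? ?; lra.
Qed.

(** The difference of the two masses is the odd function whose value at [c > 0]
    is [P(|Z| <= c)]; for each [c != 0] one of the two terms is [0]. *)
Lemma is_derive_mean_loss k1 k2 c :
  is_derive c (1 : R) (fun c : R => mean f (fun z => loss k1 k2 (z + c)))
    ((k1 - k2) / 2 + (k1 + k2) / 2 * (mass_le f c - mass_le f (- c))).
Proof.
set d := (k1 - k2) / 2; set s := (k1 + k2) / 2.
apply: (@is_derive_quadratic_remainder _ _ _ _ (`|s| * (8 * f 0))) => h.
rewrite !(mean_loss uf) !mean_normrD_max opprD -/d -/s.
have := mean_max_remainder c h; have := mean_max_remainder (- c) (- h).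
set a1 := mean f _; set a2 := mean f _; set b1 := mean f _; set b2 := mean f _.
rewrite sqrrN; set g1 := mass_le f _; set g2 := mass_le f _ => h1 h2.
rewrite (_ : _ - _ = s * ((a1 - a2 - - h * g1) + (b1 - b2 - h * g2)));
  last by ring.
rewrite normrM -!mulrA ler_wpM2l// (le_trans (ler_normD _ _))//; lra.
Qed.

End loss_derivative.

(** * The variance decreases at the critical point *)

(** The three hypotheses linking [G], [A], [B], [W] give
    [A^2 - G W <= 0], [2 A B <= c G B] and [c^2 (1 - G^2) <= 2 c G B]; they
    leave at most [- c G B - G W] from the expanded expression. *)
Lemma variance_gap_lt0 (R : realType) (c G A B W : R) :
  0 < c -> 0 < G -> G < 1 -> A <= c / 2 * G -> c * (1 - G ^+ 2) <= 2 * G * B ->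
  (forall t, 0 <= W - 2 * t * A + t ^+ 2 * G) ->
  c ^+ 2 - (c * G + B) ^+ 2 + (A + B) ^+ 2 - 2 * G * (W + c * B) < 0.
Proof.
move=> c0 G0 G1 Ale Bge Wge.
have GW : A ^+ 2 <= G * W.
  (* [A / G] minimizes the quadratic in [t] *)
  have := Wge (A / G).
  rewrite (_ : _ + _ = (G * W - A ^+ 2) / G); last by field; rewrite gt_eqF.
  by rewrite pmulr_lge0 ?invr_gt0// subr_ge0.
have G21 : 0 < 1 - G ^+ 2 by nra.
have GB : 0 < G * B.
  have : 0 < c * (1 - G ^+ 2) by rewrite mulr_gt0.
  lra.
have B0 : 0 < B by rewrite -(pmulr_rgt0 _ G0).
have AB : A * B <= c / 2 * G * B by rewrite ler_pM2r.
have cGB : 0 < c * (G * B) by rewrite mulr_gt0.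
have c2 : c * (c * (1 - G ^+ 2)) <= c * (2 * G * B) by rewrite ler_pM2l.
have A2 := sqr_ge0 A.
lra.
Qed.

Section variance_drop.
Context {R : realType} {f : R -> R}.
Context (uf : unimodal_density f).
Implicit Types (c : R).

Definition loss_variance (g : R -> R) (k1 k2 c : R) : R :=
  let L := fun z => loss k1 k2 (z + c) in
  mean g (fun z => (L z - mean g L) ^+ 2).

Lemma mass_le_lt0 c : c < 0 -> mass_le f c = 0.
Proof.
move=> c0; rewrite -(mean_cst uf 0); apply: eq_mean => z.
by rewrite ifN// -ltNge (lt_le_trans c0).
Qed.

Lemma mass_le_gt0 c : 0 < c -> 0 < mass_le f c.
Proof.
move=> c0; apply: lt_le_trans (mass_le_ge uf c0).
by rewrite !mulr_gt0// (ud_gt0 uf).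
Qed.

(** Take [r = c / G] in [abs_gt_ge]: a uniform density [G / c] on [[0, r]] would
    have mass [G] on [[0, c]] and total mass [1].  Since [f c <= G / (2 c)]
    ([mass_le_ge]), this uniform law is the extremal case. *)
Lemma abs_gt_mass c : 0 < c ->
  c * (1 - mass_le f c ^+ 2) <= 2 * mass_le f c * abs_gt f c.
Proof.
move=> c0; have G0 := mass_le_gt0 c0; have G1 := mass_le_lt1 uf (ltW c0).
have fG := mass_le_ge uf c0.
set G := mass_le f c in G0 G1 fG *.
have cr : c < c / G by rewrite ltr_pdivlMr// gtr_pMr.
have := abs_gt_ge uf c0 cr; rewrite -/G => BG.
have e : c = G * (c / G) by rewrite mulrC divfK// gt_eqF.
set r := c / G in cr BG e *.
have r0 : 0 < r by lra.
have fr : 2 * (f c * r) <= 1.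
  have fe : f c * c = f c * (G * r) by rewrite -e.
  by rewrite -(ler_pM2l G0) mulr1 (le_trans _ fG)// fe; lra.
suff : r * (1 - G ^+ 2) <= 2 * abs_gt f c.
  move=> /(ler_wpM2l (ltW G0)) h.
  by rewrite [X in X * (1 - _)]e; lra.
have BG2 : r * (1 - G) - f c * (r * (1 - G)) ^+ 2 <= abs_gt f c.
  have rG : r * (1 - G) = r - c by rewrite [in RHS]e; ring.
  by rewrite [in X in _ - X]rG.
have : 0 <= r * (1 - G) ^+ 2 * (1 - 2 * (f c * r)).
  by rewrite mulr_ge0 ?subr_ge0// mulr_ge0 ?sqr_ge0// ltW.
lra.
Qed.

Lemma mean_mul_normr0 : mean f (fun z => z * `|z + 0|) = 0.
Proof.
have := mean_mul_normrD_opp uf 0.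
have -> : mean f (fun z => z * `|z - 0|) = mean f (fun z => z * `|z + 0|).
  by apply: eq_mean => z; rewrite subr0 addr0.
lra.
Qed.

(** Reflecting [Z] exchanges the two slopes of the loss. *)
Lemma loss_variance_opp k1 k2 c :
  loss_variance f k1 k2 (- c) = loss_variance f k2 k1 c.
Proof.
rewrite /loss_variance !(variance_loss uf).
rewrite (mean_normrD_opp uf) (mean_mul_normrD_opp uf).
by move: (mean _ _) (mean _ _) (mean _ _) => m2 m h; field.
Qed.

Lemma loss_variance_lt_pos k1 k2 c : 0 < k1 -> 0 < k2 -> 0 < c ->
  (k1 - k2) / 2 + (k1 + k2) / 2 * mass_le f c = 0 ->
  loss_variance f k1 k2 c < loss_variance f k1 k2 0.
Proof.
move=> k10 k20 c0 dE; rewrite /loss_variance !(variance_loss uf).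
rewrite mean_mul_normr0.
have -> : mean f (fun z => `|z + 0|) = mean f (fun z => `|z|).
  by apply: eq_mean => z; rewrite addr0.
rewrite (mean_normr_split uf c) (mean_normrD uf (ltW c0)).
rewrite (mean_mul_normrD uf (ltW c0)).
have := variance_gap_lt0 c0 (mass_le_gt0 c0) (mass_le_lt1 uf (ltW c0))
  (abs_le_le uf c0) (abs_gt_mass c0) (sqr_le_ge uf c).
move: dE; set G := mass_le f c; set B := abs_gt f c; set A := abs_le f c;
  set W := sqr_le f c; set s := (k1 + k2) / 2; set d := (k1 - k2) / 2.
move=> dE gap; have s0 : 0 < s by rewrite divr_gt0// addr_gt0.
move: (mean f _) G B A W s d dE s0 gap => m2 G B A W s d dE s0 gap.
have -> : d = - (s * G) by lra.
rewrite -subr_lt0; set X := (X in X < 0).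
have -> : X = s ^+ 2 * (c ^+ 2 - (c * G + B) ^+ 2 + (A + B) ^+ 2
    - 2 * G * (W + c * B)) by rewrite /X; ring.
by rewrite pmulr_rlt0// exprn_gt0.
Qed.

Lemma loss_variance_lt k1 k2 c : 0 < k1 -> 0 < k2 -> c != 0 ->
  (k1 - k2) / 2 + (k1 + k2) / 2 * (mass_le f c - mass_le f (- c)) = 0 ->
  loss_variance f k1 k2 c < loss_variance f k1 k2 0.
Proof.
move=> k10 k20; case: ltrgt0P => // c0 _ dE.
  apply: loss_variance_lt_pos => //; move: dE.
  by rewrite [mass_le f (- c)]mass_le_lt0 ?subr0// oppr_lt0.
have nc0 : 0 < - c by rewrite oppr_gt0.
have dE' : (k2 - k1) / 2 + (k2 + k1) / 2 * mass_le f (- c) = 0.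
  move: dE; rewrite [mass_le f c]mass_le_lt0//.
  by move: (mass_le f (- c)) => G dE; lra.
have := loss_variance_lt_pos k20 k10 nc0 dE'.
have -> : loss_variance f k2 k1 0 = loss_variance f k1 k2 0.
  by rewrite -[in RHS]oppr0 loss_variance_opp.
by rewrite -loss_variance_opp opprK.
Qed.

Lemma critical_point_eq0 k1 k2 c : 0 < k1 -> 0 < k2 ->
  (k1 - k2) / 2 + (k1 + k2) / 2 * (mass_le f c - mass_le f (- c)) = 0 ->
  c = 0 <-> k1 = k2.
Proof.
move=> k10 k20 dE; split=> [c0|k12].
  by move: dE; rewrite c0 oppr0 subrr mulr0 addr0; lra.
apply/eqP; apply: contraT; case: ltrgt0P => // c0 _; move: dE.
  have := mass_le_gt0 c0; rewrite [mass_le f (- c)]mass_le_lt0 ?oppr_lt0//.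
  by rewrite k12; nra.
have nc0 : 0 < - c by rewrite oppr_gt0.
by have := mass_le_gt0 nc0; rewrite [mass_le f c]mass_le_lt0// k12; nra.
Qed.

End variance_drop.

(** * The generalized Gaussian density *)

Lemma integrable_oneDsqrV (R : realType) :
  (@lebesgue_measure R).-integrable [set: R]
    (fun z : R => ((1 + z ^+ 2)^-1)%:E).
Proof.
have c1 : continuous (fun z : R => (1 + z ^+ 2)^-1).
  exact: continuous_oneDsqrV.
apply/integrableP; split.
  by apply/measurable_EFinP; exact: continuous_measurable_fun.
under eq_integral do rewrite /= ger0_norm ?invr_ge0 ?addr_ge0 ?sqr_ge0//.
rewrite ge0_symfun_integralT//.
- have := @integral0y_oneDsqr R; rewrite set_itvcy => ->.
  by rewrite -EFinM ltry.
- by move=> z; rewrite invr_ge0 addr_ge0 ?sqr_ge0.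
- by move=> z /=; rewrite sqrrN.
Qed.

(** With [y = |z / b|] and an integer [n >= 4 a], the exponential series gives
    [exp(y^(1/a)) >= y^(n/a) / n!], which is at least [y^4 / n!] for [y >= 1].
    This compensates the quartic growth of [z^2 (1 + z^2)], for every [a > 0]. *)
Lemma sqr_expRN_powR_bound (R : realType) (a b : R) : 0 < a -> 0 < b ->
  exists M : R, forall z,
    z ^+ 2 * (1 + z ^+ 2) * expR (- (`|z / b| `^ a^-1)) <= M.
Proof.
move=> a0 b0; pose n := (Num.truncn (4 * a)).+1.
have na : 4 * a <= n%:R by rewrite ltW// truncnS_gt.
exists (b ^+ 2 * (1 + b ^+ 2) * n`!%:R) => z.
set y := `|z / b|; have y0 : 0 <= y by exact: normr_ge0.
have -> : z ^+ 2 = b ^+ 2 * y ^+ 2.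
  rewrite /y real_normK ?num_real// expr_div_n mulrCA divff ?mulr1//.
  by rewrite expf_neq0// gt_eqF.
have b2 : 0 < b ^+ 2 by rewrite exprn_gt0.
have y2 : 0 <= y ^+ 2 by rewrite sqr_ge0.
have n1 : 1 <= n`!%:R :> R by rewrite ler1n fact_gt0.
have [y1|y1] := lerP y 1.
  have e1 : expR (- (y `^ a^-1)) <= 1 by rewrite expR_le1 oppr_le0 powR_ge0.
  have y21 : y ^+ 2 <= 1 by rewrite expr_le1.
  have e0 := expR_ge0 (- (y `^ a^-1)).
  set Y := y ^+ 2 in y2 y21 *; set B := b ^+ 2 in b2 *.
  have BY : B * Y <= B by rewrite ler_piMr// ltW.
  have BY0 : 0 <= B * Y by rewrite mulr_ge0// ltW.
  apply: ler_pM => //; first by rewrite mulr_ge0// addr_ge0.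
    by apply: ler_pM => //; rewrite ?lerD2l// addr_ge0.
  exact: le_trans n1.
have yn : y ^+ 4 / n`!%:R <= expR (y `^ a^-1).
  apply: (@le_trans _ _ (1 + (y `^ a^-1) ^+ n / n`!%:R)); last first.
    by rewrite expR_ge1Dxn// powR_ge0.
  rewrite (@le_trans _ _ ((y `^ a^-1) ^+ n / n`!%:R)) ?lerDr//.
  rewrite ler_pM2r ?invr_gt0 ?(lt_le_trans ltr01)//.
  rewrite -!powR_mulrn ?powR_ge0// -powRrM ler_powR ?(ltW y1)//.
  by rewrite mulrC ler_pdivlMr.
rewrite expRN ler_pdivrMr ?expR_gt0//.
have n0 : 0 < n`!%:R :> R by rewrite (lt_le_trans ltr01).
have : b ^+ 2 * (1 + b ^+ 2) * y ^+ 4 <=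
    b ^+ 2 * (1 + b ^+ 2) * n`!%:R * expR (y `^ a^-1).
  rewrite -[leRHS]mulrA ler_pM2l; last by rewrite mulr_gt0// addr_gt0.
  by rewrite mulrC -ler_pdivrMr.
apply: le_trans.
have y21 : 1 <= y ^+ 2 by rewrite exprn_ege1// ltW.
rewrite (_ : y ^+ 4 = (y ^+ 2) ^+ 2); last by rewrite -exprM.
set Y := y ^+ 2 in y2 y21 *; set B := b ^+ 2 in b2 *.
have : 0 <= B * (Y * (Y - 1)) by rewrite !mulr_ge0 ?subr_ge0// ltW.
lra.
Qed.

(** The constant factor is nonnegative, and the normalization excludes
    [0]; the second moment is finite by comparison with a multiple of
    [1 / (1 + z^2)]. *)
Lemma gen_gauss_pdf_unimodal (R : realType) (a b : R) : 0 < a -> 0 < b ->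
  (\int[@lebesgue_measure R]_z (gen_gauss_pdf a b z)%:E = 1)%E ->
  unimodal_density (gen_gauss_pdf a b).
Proof.
move=> a0 b0 int1.
set K := (2 * a * b * Gamma a)^-1.
have K_ge0 : 0 <= K.
  rewrite invr_ge0 !mulr_ge0 ?(ltW a0) ?(ltW b0)//.
  by apply: Rintegral_ge0 => t _; rewrite mulr_ge0 ?powR_ge0 ?expR_ge0.
have K_gt0 : 0 < K.
  rewrite lt_neqAle K_ge0 andbT; apply/eqP => K0.
  move: int1; under eq_integral do rewrite /gen_gauss_pdf -/K -K0 mul0r.
  by rewrite integral0 => /eqP; rewrite eq_sym onee_eq0.
have mf : measurable_fun [set: R] (gen_gauss_pdf a b).
  apply: measurable_funM => //; apply: measurableT_comp => //.
  apply: measurableT_comp => //.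
  apply: (measurableT_comp (measurable_powR _)) => //.
  by apply: measurableT_comp => //; exact: measurable_funM.
have f_gt0 z : 0 < gen_gauss_pdf a b z by rewrite mulr_gt0 ?expR_gt0.
split; [exact: mf|exact: f_gt0| | |exact: int1|].
- by move=> z; rewrite /gen_gauss_pdf mulNr normrN.
- move=> x y x0 xy; rewrite /gen_gauss_pdf -/K (ler_pM2l K_gt0) ler_expR lerN2.
  have y0 := le_trans x0 xy.
  rewrite !ger0_norm ?divr_ge0 ?(ltW b0)//.
  apply: ge0_ler_powR;
    rewrite ?nnegrE ?invr_ge0 ?divr_ge0 ?(ltW a0) ?(ltW b0)//.
  by rewrite ler_pM2r ?invr_gt0.
- have [M hM] := sqr_expRN_powR_bound a0 b0.
  have := integrableZl measurableT (K * M) (integrable_oneDsqrV R).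
  apply: le_integrable => //.
    by apply/measurable_EFinP; apply: measurable_funM.
  move=> z _ /=; rewrite lee_fin.
  rewrite (ger0_norm (mulr_ge0 (sqr_ge0 z) (ltW (f_gt0 z)))).
  rewrite (le_trans _ (ler_norm _))//.
  have z1 : 0 < 1 + z ^+ 2 by rewrite ltr_pwDl ?sqr_ge0.
  rewrite ler_pdivlMr// /gen_gauss_pdf -/K mulrCA -mulrA ler_pM2l//.
  by rewrite mulrAC hM.
Qed.

(** * From the density to the random variable *)

Section law_of_density.
Context {d} {T : measurableType d} {R : realType} {P : probability T R}.
Context {Z : {RV P >-> R}} {f : R -> R}.
Context (uf : unimodal_density f) (fZ : has_density Z f).
Implicit Types (c : R).

Lemma expectation_mean (phi : R -> R) : subquadratic phi ->
  ('E_P[fun w => phi (Z w)] = (mean f phi)%:E)%E.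
Proof.
move=> qphi.
rewrite (expectation_density (ud_measurable uf) _ fZ (proj1 qphi)).
  rewrite fineK//; apply: integrable_fin_num => //.
  exact: subquadratic_integrable.
by move=> z; rewrite ltW// (ud_gt0 uf).
Qed.

Lemma expected_loss_mean k1 k2 :
  expected_loss Z k1 k2 = fun c => mean f (fun z => loss k1 k2 (z + c)).
Proof.
apply/funext => c; rewrite /expected_loss.
by rewrite (expectation_mean (subquadratic_loss k1 k2 c)).
Qed.

Lemma variance_loss_variance k1 k2 c :
  ('V_P[fun w => loss k1 k2 (Z w + c)] = (loss_variance f k1 k2 c)%:E)%E.
Proof.
rewrite /variance unlock (expectation_mean (subquadratic_loss k1 k2 c))/=.
rewrite -(expectation_mean (subquadratic_sqr_loss k1 k2 c _)).
by congr expectation; apply/funext => w; rewrite fctE/= expr2.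
Qed.

End law_of_density.

Theorem theorem3 (R : realType) (d : measure_display) (T : measurableType d)
    (P : probability T R) (a b k1 k2 : R)
    (a_gt0 : 0 < a) (b_gt0 : 0 < b) (k1_gt0 : 0 < k1) (k2_gt0 : 0 < k2)
    (Z : {RV P >-> R}) (fZ : has_density Z (gen_gauss_pdf a b))
    (C : R) (hC : is_derive C (1 : R) (expected_loss Z k1 k2) (0 : R)) :
  [/\ ('V_P[fun w => loss k1 k2 (Z w + C)%R]
         <= 'V_P[fun w => loss k1 k2 (Z w)])%E,
      'V_P[fun w => loss k1 k2 (Z w + C)%R]%E
        = 'V_P[fun w => loss k1 k2 (Z w)]%E <-> C = 0
    & C = 0 <-> k1 = k2].
Proof.
have uf : unimodal_density (gen_gauss_pdf a b).
  apply: gen_gauss_pdf_unimodal => //.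
  by rewrite -fZ// probability_setT.
have critical : (k1 - k2) / 2 + (k1 + k2) / 2 *
    (mass_le (gen_gauss_pdf a b) C - mass_le (gen_gauss_pdf a b) (- C)) = 0.
  have dC := is_derive_mean_loss uf k1 k2 C.
  rewrite -(expected_loss_mean uf fZ) in dC.
  by rewrite -(@derive_val _ _ _ _ _ _ _ dC) (@derive_val _ _ _ _ _ _ _ hC).
have V0 : (fun w => loss k1 k2 (Z w)) = (fun w => loss k1 k2 (Z w + 0)).
  by apply/funext => w; rewrite addr0.
rewrite V0 !(variance_loss_variance uf fZ) lee_fin.
have lt_V := loss_variance_lt uf k1_gt0 k2_gt0 _ critical.
split.
- by have [->//|/lt_V/ltW] := eqVneq C 0.
- split=> [[VE]|-> //]; apply/eqP; apply: contraT => /lt_V.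
  by rewrite VE ltxx.
- exact: critical_point_eq0 critical.
Qed.
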